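(* Let $n\ge 2$. For $r\ge 1$ let $\mathcal H_r$ be the set of all $(n-1)$-dimensional linear subspaces of $\mathbb R^n$ that contain $n-1$ linearly independent points of $\mathbb Z^n$ of Euclidean norm at most $r$. There exist positive constants $c_1,c_2$ depending only on $n$ such that $$c_1 r^{n(n-1)}\le|\mathcal H_r|\le c_2 r^{n(n-1)}$$ for all sufficiently large $r$. *)

(* Defs.v *)
From HB Require Import structures.
From mathcomp Require Import all_boot all_order all_algebra.
From mathcomp Require Import all_classical all_reals all_analysis.

Set Implicit Arguments.
Unset Strict Implicit.
Unset Printing Implicit Defensive.

Import Order.TTheory GRing.Theory Num.Theory.
Local Open Scope classical_set_scope.
Local Open Scope ring_scope.

(* The library norm `|v| on row vectors is the sup norm, hence this one. *)
Definition eucl_norm (R : realType) (n : nat) (v : 'rV[R]_n) : R :=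
  Num.sqrt (\sum_(i < n) v 0 i ^+ 2).

Definition lattice_hyperplanes (R : realType) (n : nat) (r : R) :
    set {vspace 'rV[R]_n} :=
  [set U | \dim U = n.-1 /\
     exists X : n.-1.-tuple 'rV[R]_n,
       free X /\
       forall v, v \in X ->
         [/\ v \in U, v \is a mxOver Num.int & eucl_norm v <= r]].

Arguments lattice_hyperplanes {R} n r.

(* Main.v *)
(** Write d = n - 1. The upper bound counts the d-tuples of integer points in a
    box of side O(r).

    For the lower bound take the hyperplanes spanned by the rows of [w | B] with
    B = 2ds I + P, where P and w have integer entries in [0, s) and s is of order
    r. Such a hyperplane determines y = B^-1 w, so it suffices to count the
    distinct y among these s^(d(d+1)) pairs. Let m be the denominator of y. The
    rows of B belong to the lattice {x in Z^d : x.y in Z}, which has index m in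
    Z^d. The translates of this lattice by representatives of its m cosets are
    disjoint, and reduction modulo the rows of B puts the representatives in a
    box of side O(s); so the lattice has O(s^d / m) points in such a box, and at
    most O(s^d / m)^d pairs (P, w) give the same y. Since B is diagonally
    dominant, |y_i| <= 1, whence O(m)^d values y have denominator m. Each m thus
    accounts for O(s^(d^2)) pairs, so that half of all pairs have
    m >= c s^d, and there the multiplicity of y is bounded. *)
Require Import Defs.
From mathcomp Require Import all_boot all_order all_algebra.
From mathcomp Require Import finmap.
From mathcomp Require Import all_classical all_reals all_analysis.
From mathcomp Require Import zify lra.

Import Order.TTheory GRing.Theory Num.Theory.
Local Open Scope ring_scope.

(** * Counting by fibres, and diagonally dominant systems *)

Lemma card_le_fibers (T : finType) (V : eqType) (A : {set T}) (f : T -> V)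
    (s : seq V) (N : nat) :
  (forall a, a \in A -> f a \in s) ->
  (forall c, (#|[set a in A | f a == c]| <= N)%N) ->
  (#|A| <= size s * N)%N.
Proof.
move=> fA hN; elim: s A fA hN => [|c s IH] A fA hN.
  rewrite leqn0 cards_eq0; apply/eqP/finset.setP => a; rewrite inE.
  by apply/negP => /fA.
rewrite /= mulSn -(cardsID [set a | f a == c] A) leq_add //.
  by apply: leq_trans (hN c); rewrite subset_leq_card //; apply/fintype.subsetP => a; rewrite !inE.
apply: IH => [a|e].
  by rewrite !inE => /andP[/negPf fc /fA]; rewrite inE fc.
apply: leq_trans (hN e); rewrite subset_leq_card //.
by apply/fintype.subsetP => a; rewrite !inE => /andP[/andP[_ ->] ->].
Qed.

(** Read the equation at an index [i] where |y_i| is maximal: there the contribution of [P] is at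
    most d a |y_i|, and the term t y_i outweighs it. *)
Lemma diag_dominant_bound (R : realFieldType) (d : nat) (t a b : R)
    (P : 'M[R]_d) (y w : 'cV[R]_d) :
  0 <= t -> (forall i j, 0 <= P i j <= a) -> (forall i, `|w i 0| <= b) ->
  (t%:M + P) *m y = w -> d%:R * a < t ->
  forall i, `|y i 0| <= b / (t - d%:R * a).
Proof.
move=> t0 hP hw hy dat i0.
rewrite ler_pdivlMr ?subr_gt0//.
case: (arg_maxP (fun i => `|y i 0|) (isT : xpredT i0)) => i _ hi.
apply: le_trans (_ : `|y i 0| * (t - d%:R * a) <= _).
  apply: ler_wpM2r; [by rewrite subr_ge0 ltW | exact: hi].
have: t * y i 0 = w i 0 - \sum_j P i j * y j 0.
  by rewrite -hy mulmxDl mul_scalar_mx !mxE addrK.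
move=> /(congr1 Num.norm); rewrite normrM (ger0_norm t0) => e.
have {e} : t * `|y i 0| <= b + \sum_(j < d) a * `|y i 0|.
  rewrite e; apply: (le_trans (ler_normB _ _)); apply: lerD => //.
  apply: (le_trans (ler_norm_sum _ _ _)); apply: ler_sum => j _.
  have /andP[p0 pa] := hP i j.
  by rewrite normrM (ger0_norm p0) ler_pM//; exact: (hi j isT).
rewrite sumr_const card_ord -mulr_natl; lra.
Qed.

(** * Bounded integer matrices and common denominators *)

(** Ordinal entries make the integer matrices with entries in [0, L) a finite type, so that they can
    be counted before being mapped to real matrices. *)
Definition natmx {R : realType} {p q L : nat} (v : 'M['I_L]_(p, q)) : 'M[R]_(p, q) :=
  map_mx (fun i : 'I_L => i%:R) v.

Section Natmx.
Variables (R : realType) (p q L : nat).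

Lemma natmx_inj : injective (@natmx R p q L).
Proof.
move=> u v /matrixP e; apply/matrixP => i j; apply/val_inj/eqP.
by have := e i j; rewrite !mxE => /eqP; rewrite eqr_nat.
Qed.

Lemma natmx_int (v : 'M['I_L]_(p, q)) : @natmx R _ _ _ v \is a mxOver Num.int.
Proof. by apply/mxOverP => i j; rewrite mxE natr_int. Qed.

Lemma natmx_surj (A : 'M[R]_(p, q)) : A \is a mxOver Num.int ->
  (forall i j, 0 <= A i j < L%:R) -> exists v : 'M['I_L]_(p, q), natmx v = A.
Proof.
move=> /mxOverP hA hL.
have tA i j : (Num.truncn (A i j))%:R = A i j.
  by apply/eqP; rewrite -natrEtruncn natrEint hA; case/andP: (hL i j).
have tL i j : (Num.truncn (A i j) < L)%N.
  by rewrite -(ltr_nat R) tA; case/andP: (hL i j).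
exists (\matrix_(i, j) Ordinal (tL i j)).
by apply/matrixP => i j; rewrite !mxE /= tA.
Qed.
End Natmx.

(* The subgroup of R generated by 1 and the entries of y has generator 1/m. *)
Lemma common_denominator (R : realType) (d q : nat) (y : 'cV[R]_d) :
  (0 < q)%N -> q%:R *: y \is a mxOver Num.int ->
  exists m : nat, exists x : 'rV[R]_d,
    [/\ (0 < m)%N, m%:R *: y \is a mxOver Num.int,
        x \is a mxOver Num.int & (x *m y) 0 0 - m%:R^-1 \is a Num.int].
Proof.
move=> q0 /mxOverP qy.
have qR : q%:R != 0 :> R by rewrite pnatr_eq0 -lt0n.
(* [G] is this subgroup scaled by [q], which places it inside the integers. Its least positive
   element [g] generates it, and m = q / g. *)
pose G (v : R) := exists x : 'rV[R]_d, exists k : R,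
  [/\ x \is a mxOver Num.int, k \is a Num.int & ((x *m y) 0 0 + k) * q%:R = v].
have G1 : G q%:R.
  by exists 0, 1; rewrite mxOver0 ?rpred0// rpred1 mul0mx mxE add0r mul1r.
have Gy i : G (q%:R * y i 0).
  exists (delta_mx 0 i), 0; rewrite rpred0 addr0 -rowE mxE mulrC; split=> //.
  by apply/mxOverP => a b; rewrite mxE natr_int.
have GB u v z : G u -> G v -> z \is a Num.int -> G (u - z * v).
  move=> [x [k [/mxOverP hx hk <-]]] [x' [k' [/mxOverP hx' hk' <-]]] hz.
  exists (x - z *: x'), (k - z * k'); split.
  - by apply/mxOverP => i j; rewrite !mxE rpredB// rpredM.
  - by rewrite rpredB// rpredM.
  - by rewrite mulmxBl -scalemxAl !mxE; lra.
have Gi v : G v -> v \is a Num.int.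
  move=> [x [k [/mxOverP hx hk <-]]]; rewrite mulrDl.
  apply: rpredD; last by rewrite rpredM// natr_int.
  rewrite mxE mulr_suml rpred_sum// => i _; rewrite -mulrA rpredM//.
  by have := qy i 0; rewrite mxE mulrC.
have ex : exists g : nat, (0 < g)%N && `[< G g%:R >].
  by exists q; rewrite q0; apply/asboolP.
case: (ex_minnP ex) => g /andP[g0 /asboolP Gg] gmin.
have gR : g%:R != 0 :> R by rewrite pnatr_eq0 -lt0n.
(* Division with remainder: the remainder [e] lies in [G] and is smaller than [g], so it
   vanishes. *)
have div v : G v -> v / g%:R \is a Num.int.
  move=> Gv; set z := Num.floor (v / g%:R).
  have : G (v - z%:~R * g%:R) by apply: GB => //; rewrite intr_int.
  set e := v - _ => Ge.
  have gp : 0 < g%:R :> R by rewrite ltr0n.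
  have e0 : 0 <= e by rewrite subr_ge0 -ler_pdivlMr// floor_le.
  have eg : e < g%:R.
    have := floorD1_gt (v / g%:R).
    by rewrite ltr_pdivrMr// intrD mulrDl mul1r ltrBlDr addrC.
  have : e \is a Num.nat by rewrite natrEint Gi.
  move=> /natrP[N eN]; have : ~~ (0 < N)%N.
    apply/negP => N0; have := gmin N; rewrite N0 -eN (asboolT Ge) => /(_ isT).
    by rewrite leqNgt -(ltr_nat R) -eN eg.
  rewrite -eqn0Ngt => /eqP N0; move: eN; rewrite N0 => /eqP.
  by rewrite subr_eq0 => /eqP ->; rewrite mulfK// intr_int.
have [x [k [hx hk e]]] := Gg.
have : q%:R / g%:R \is a @Num.nat R by rewrite natrEint div// divr_ge0.
move=> /natrP[m em].
have mR : m%:R != 0 :> R by rewrite -em mulf_neq0// invr_eq0.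
exists m, x; split=> //.
- by rewrite lt0n -(pnatr_eq0 R).
- apply/mxOverP => i j; rewrite mxE -em ord1 mulrAC; exact: div.
- have -> : (x *m y) 0 0 - m%:R^-1 = - k; last by rewrite rpredN.
  by rewrite -em -e invf_div mulfK// opprD addrA subrr sub0r.
Qed.

(** * Points of the lattice of integral pairing with [y] in a box *)

Lemma residue_in_box {R : realType} {d L : nat} {B : 'M[R]_d} {y : 'cV[R]_d}
    (x : 'rV[R]_d) :
  B \in unitmx -> B \is a mxOver Num.int -> (forall i j, 0 <= B i j) ->
  (forall j, \sum_i B i j < L%:R) -> B *m y \is a mxOver Num.int ->
  x \is a mxOver Num.int ->
  exists v : 'rV['I_L]_d, ((x - natmx v) *m y) 0 0 \is a Num.int.
Proof.
move=> uB /mxOverP iB pB sB /mxOverP iBy /mxOverP ix.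
(* Rounding down the coordinates of [x] in the basis of rows of [B] leaves a point of the
   parallelepiped they span. As [B] is nonnegative, each coordinate of that point lies between 0 and
   a column sum of [B]; as B y is integral, the pairing with [y] changes by an integer. *)
pose f := x *m invmx B.
pose c : 'rV[R]_d := \row_k (Num.floor (f 0 k))%:~R.
have ef : (f - c) *m B = x - c *m B by rewrite mulmxBl mulmxKV.
have e0 k : 0 <= (f - c) 0 k by rewrite !mxE subr_ge0 floor_le.
have e1 k : (f - c) 0 k <= 1.
  by have := floorD1_gt (f 0 k); rewrite !mxE intrD; lra.
have [||v hv] := @natmx_surj R 1 d L (x - c *m B).
- apply/mxOverP => i j; rewrite !mxE rpredB// rpred_sum// => k _.
  by rewrite !mxE rpredM// intr_int.
- move=> i j; rewrite -ef ord1 mxE sumr_ge0/= => [|k _]; last by rewrite mulr_ge0.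
  apply: le_lt_trans (sB j); apply: ler_sum => k _.
  by rewrite -[leRHS]mul1r ler_wpM2r.
exists v; rewrite hv opprB addrCA subrr addr0 -mulmxA mxE rpred_sum// => k _.
by apply: rpredM (iBy k 0); rewrite mxE intr_int.
Qed.

Definition dual_box {R : realType} {d : nat} (L : nat) (y : 'cV[R]_d) :
    {set 'rV['I_L]_d} :=
  [set v | (natmx v *m y) 0 0 \is a Num.int]%SET.

Lemma ltn_ord_add {L : nat} (i j : 'I_L) : (i + j < L + L)%N.
Proof. by rewrite -addnS leq_add// ltnW. Qed.

(** Let t_j be the residue of j x in the box, so that t_j pairs with [y] to j/m modulo 1. The map
    (v, j) -> v + t_j is injective, and its values lie in a box of side 2L. *)
Lemma card_dual_box (R : realType) (d L m : nat) (B : 'M[R]_d) (y : 'cV[R]_d)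
    (x : 'rV[R]_d) :
  B \in unitmx -> B \is a mxOver Num.int -> (forall i j, 0 <= B i j) ->
  (forall j, \sum_i B i j < L%:R) -> B *m y \is a mxOver Num.int ->
  (0 < m)%N -> x \is a mxOver Num.int -> (x *m y) 0 0 - m%:R^-1 \is a Num.int ->
  (#|dual_box L y| * m <= (L + L) ^ d)%N.
Proof.
move=> uB iB pB sB iBy m0 ix hx.
have mR : 0 < m%:R :> R by rewrite ltr0n.
have ht (j : 'I_m) : exists v : 'rV['I_L]_d,
    (natmx v *m y) 0 0 - j%:R / m%:R \is a Num.int.
  have [|v hv] := residue_in_box (j%:R *: x) uB iB pB sB iBy.
    by apply/mxOverP => a b; rewrite mxE rpredM ?natr_int// (mxOverP ix).
  exists v; rewrite (_ : _ - _ = j%:R * ((x *m y) 0 0 - m%:R^-1)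
      - ((j%:R *: x - natmx v) *m y) 0 0).
    by rewrite rpredB// rpredM ?natr_int.
  by rewrite mulmxBl -scalemxAl !mxE; lra.
have [t tP] := fin_all_exists ht.
pose F (p : 'rV['I_L]_d * 'I_m) : 'rV['I_(L + L)]_d :=
  \row_k Ordinal (ltn_ord_add (p.1 0 k) (t p.2 0 k)).
have FE p : @natmx R _ _ _ (F p) = natmx p.1 + natmx (t p.2).
  by apply/matrixP => a k; rewrite !mxE ord1 /= natrD.
have Fi : {in finset.setX (dual_box L y) [set: 'I_m]%SET &, injective F}.
  move=> [v i] [w j]; rewrite !inE /= !andbT => hv hw e.
  have {}e : natmx v + natmx (t i) = natmx w + natmx (t j) :> 'rV[R]_d.
    by rewrite -(FE (v, i)) -(FE (w, j)) e.
  (* Equal sums pair equally with [y], so i/m and j/m agree modulo 1; since i, j < m this forces i =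
     j. *)
  have h : (i%:R - j%:R) / m%:R \is a @Num.int R.
    have -> : (i%:R - j%:R) / m%:R =
        ((natmx (t j) *m y) 0 0 - j%:R / m%:R) -
        ((natmx (t i) *m y) 0 0 - i%:R / m%:R) +
        ((natmx w *m y) 0 0 - (natmx v *m y) 0 0) :> R.
      have := congr1 (fun A : 'rV[R]_d => (A *m y) 0 0) e.
      by rewrite !mulmxDl !mxE; lra.
    by rewrite rpredD// rpredB.
  have ij : i = j.
    apply/val_inj => /=; apply/eqP; rewrite -(eqr_nat R) -subr_eq0.
    have /intrP[z hz] := h.
    suff z0 : z = 0.
      by move/eqP: hz; rewrite z0 mulf_eq0 invr_eq0 (gt_eqF mR) orbF.
    have ei : i%:R < m%:R :> R by rewrite ltr_nat.
    have ej : j%:R < m%:R :> R by rewrite ltr_nat.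
    have i0 : 0 <= i%:R :> R by [].
    have j0 : 0 <= j%:R :> R by [].
    have : z%:~R < 1%:~R :> R by rewrite -hz ltr_pdivrMr//; lra.
    have : (-1)%:~R < z%:~R :> R by rewrite -hz ltr_pdivlMr//; lra.
    by rewrite !ltr_int; lia.
  subst j; congr (_, _); apply: (@natmx_inj R); exact: addIr e.
have := leq_card_in _ _ Fi.
by rewrite cardsX cardsT card_ord card_mx card_ord mul1n.
Qed.

(** * Integrality of determinants and adjugates *)

Lemma det_int (R : realType) (d : nat) (A : 'M[R]_d) :
  A \is a mxOver Num.int -> \det A \is a Num.int.
Proof.
move=> /mxOverP iA; rewrite rpred_sum// => s _.
by rewrite rpredM ?rpred_prod// rpredX// rpredN rpred1.
Qed.

Lemma adj_int (R : realType) (d : nat) (A : 'M[R]_d) :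
  A \is a mxOver Num.int -> \adj A \is a mxOver Num.int.
Proof.
move=> /mxOverP iA; apply/mxOverP => i j; rewrite mxE rpredM//.
  by rewrite rpredX// rpredN rpred1.
by apply: det_int; apply/mxOverP => k l; rewrite !mxE.
Qed.

(** The witness is |det B|: up to sign, |det B| times the inverse of [B] is the adjugate, which is
    integral. *)
Lemma cramer_denominator (R : realType) (d : nat) (B : 'M[R]_d) (w : 'cV[R]_d) :
  B \in unitmx -> B \is a mxOver Num.int -> w \is a mxOver Num.int ->
  exists2 q : nat, (0 < q)%N & q%:R *: (invmx B *m w) \is a mxOver Num.int.
Proof.
move=> uB iB /mxOverP iw.
have /natrP[q hq] : `|\det B| \is a Num.nat.
  by apply: natr_norm_int; exact: det_int.
have dB : \det B != 0 by move: uB; rewrite unitmxE unitfE.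
exists q; first by rewrite -(ltr_nat R) -hq normr_gt0.
rewrite -hq normrEsg /invmx uB -scalemxAl scalerA -mulrA mulfV// mulr1.
have /mxOverP iadj := adj_int _ _ _ iB.
apply/mxOverP => i j; rewrite !mxE rpredM//.
  by case: sgrP => _; rewrite ?rpred0 ?rpredN ?rpred1.
by rewrite rpred_sum// => k _; rewrite rpredM.
Qed.

(** * The matrices B = 2ds I + P and the multiplicities of y = B^-1 w *)

Section Family.
Variables (R : realType) (d s : nat).
Hypotheses (d_gt0 : (0 < d)%N) (s_gt0 : (0 < s)%N).
Implicit Type a : 'M['I_s]_d * 'cV['I_s]_d.

Definition perturbed_scalar a : 'M[R]_d := (2 * d * s)%:R%:M + natmx a.1.

Definition slope a : 'cV[R]_d := invmx (perturbed_scalar a) *m natmx a.2.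

Lemma natmx_range (p q : nat) (v : 'M['I_s]_(p, q)) i j :
  0 <= @natmx R _ _ _ v i j <= s%:R.
Proof. by rewrite mxE ler0n ler_nat ltnW. Qed.

Lemma perturbed_scalar_dominant : d%:R * s%:R < (2 * d * s)%:R :> R.
Proof. by rewrite -natrM ltr_nat; nia. Qed.

(** [diag_dominant_bound] with right-hand side 0 kills every solution of B y = 0. The transpose
    turns these column vectors into the rows of a [kermx]. *)
Lemma perturbed_scalar_unit a : perturbed_scalar a \in unitmx.
Proof.
rewrite -unitmx_tr -row_free_unit -kermx_eq0; apply/eqP/row_matrixP => i.
rewrite row0.
have hk : perturbed_scalar a *m (row i (kermx (perturbed_scalar a)^T))^T = 0.
  by apply: trmx_inj; rewrite trmx_mul trmxK -row_mul mulmx_ker row0 trmx0.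
have := diag_dominant_bound R d (2 * d * s)%:R s%:R 0 (natmx a.1) _ 0 _ _ _ hk.
move=> /(_ (ler0n _ _) (natmx_range _ _ _)) h.
apply/rowP => j; rewrite [RHS]mxE; apply/eqP; rewrite -normr_le0.
rewrite mul0r in h.
have := h _ perturbed_scalar_dominant j.
by rewrite !mxE; apply => k; rewrite mxE normr0.
Qed.

Lemma perturbed_scalarM_slope a : perturbed_scalar a *m slope a = natmx a.2.
Proof. by rewrite mulmxA mulmxV ?mul1mx// perturbed_scalar_unit. Qed.

Lemma perturbed_scalar_int a : perturbed_scalar a \is a mxOver Num.int.
Proof. by apply/mxOverP => i j; rewrite !mxE -mulrnA -natrD natr_int. Qed.

Lemma perturbed_scalar_ge0 a i j : 0 <= perturbed_scalar a i j.
Proof. by rewrite !mxE -mulrnA -natrD. Qed.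

Lemma perturbed_scalar_col a j :
  \sum_i perturbed_scalar a i j < (3 * d * s)%:R.
Proof.
under eq_bigr => i _ do rewrite !mxE.
rewrite big_split /= -natr_sum (bigD1 j)//= eqxx big1 => [|i /negPf ->]; last by [].
rewrite addr0 mulr1n -natrD ltr_nat.
apply: (@leq_ltn_trans (2 * d * s + \sum_(i < d) s.-1)%N).
  by rewrite leq_add2l leq_sum// => i _; rewrite -ltnS prednK.
by rewrite sum_nat_const card_ord; nia.
Qed.

Lemma slope_le1 a i : `|slope a i 0| <= 1.
Proof.
have := diag_dominant_bound R d (2 * d * s)%:R s%:R s%:R (natmx a.1) _ _ _ _ _
  (perturbed_scalarM_slope a) perturbed_scalar_dominant i.
move=> /(_ (ler0n _ _) (natmx_range _ _ _)) h.
apply: le_trans (h _) _ => [k|].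
  by have /andP[p0 ps] := natmx_range _ _ a.2 k 0; rewrite ger0_norm.
(* The bound obtained is s / (2ds - ds) = 1/d. *)
rewrite ler_pdivrMr ?subr_gt0 ?perturbed_scalar_dominant// mul1r.
by rewrite lerBrDr -natrM -natrD ler_nat; nia.
Qed.

Lemma slope_denominator a : exists m : nat, exists x : 'rV[R]_d,
    [/\ (0 < m)%N, m%:R *: slope a \is a mxOver Num.int,
        x \is a mxOver Num.int & (x *m slope a) 0 0 - m%:R^-1 \is a Num.int].
Proof.
have [q q0 hq] := cramer_denominator _ _ _ _ (perturbed_scalar_unit a)
  (perturbed_scalar_int a) (natmx_int _ _ _ _ a.2).
exact: common_denominator q0 hq.
Qed.

(** For fixed [y], the vector w = B y is determined by [P], and each row of [B] is one of the points
    counted by [card_dual_box] with L = 3ds. The fibre is thus at most the d-th power of that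
    count. *)
Lemma card_slope_fiber (y : 'cV[R]_d) (m : nat) (x : 'rV[R]_d) :
  (0 < m)%N -> x \is a mxOver Num.int ->
  (x *m y) 0 0 - m%:R^-1 \is a Num.int ->
  (#|[set a | slope a == y]%SET| * m ^ d <= ((6 * d * s) ^ d) ^ d)%N.
Proof.
move=> m0 ix hx.
(* A member of the fibre supplies the matrix that [card_dual_box] needs to reduce representatives
   into the box. *)
have [->|[a0]] := set_0Vmem [set a | slope a == y]%SET; first by rewrite cards0.
rewrite inE => /eqP ya0.
have hB a : slope a = y -> perturbed_scalar a *m y = natmx a.2.
  by move=> <-; exact: perturbed_scalarM_slope.
have := card_dual_box R d (3 * d * s) m _ y x (perturbed_scalar_unit a0)
  (perturbed_scalar_int a0) (perturbed_scalar_ge0 a0) (perturbed_scalar_col a0) _ m0 ix hx.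
rewrite hB// natmx_int => /(_ isT) hD.
have lt3 a (i k : 'I_d) : (2 * d * s * (i == k) + a.1 i k < 3 * d * s)%N.
  by have := ltn_ord (a.1 i k); case: (i == k); nia.
pose F a : {ffun 'I_d -> 'rV['I_(3 * d * s)]_d} :=
  [ffun i => \row_k Ordinal (lt3 a i k)].
have FE a i : natmx (F a i) = row i (perturbed_scalar a).
  apply/matrixP => o k; rewrite !(mxE, ffunE) /= natrD natrM.
  by case: (i == k); rewrite ?mulr1 ?mulr0 ?mulr1n ?mulr0n.
have Fi : {in [set a | slope a == y]%SET &, injective F}.
  move=> a b; rewrite !inE => /eqP ya /eqP yb e.
  have eB : perturbed_scalar a = perturbed_scalar b.
    by apply/row_matrixP => i; rewrite -!FE e.
  have : a.1 = b.1 by apply: (@natmx_inj R); exact: addrI eB.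
  have : a.2 = b.2 by apply: (@natmx_inj R); rewrite -!hB// eB.
  by case: a b {ya yb e eB} => ? ? [? ?] /= -> ->.
have Fsub : (F @: [set a | slope a == y] \subset ffun_on (mem (dual_box (3 * d * s) y)))%SET.
  apply/fintype.subsetP => f /imsetP[a]; rewrite inE => /eqP ya ->.
  apply/ffun_onP => i; rewrite inE FE -row_mul hB// mxE.
  exact: (mxOverP (natmx_int _ _ _ _ _)).
have := subset_leq_card Fsub; rewrite card_in_imset// card_ffun_on card_ord => h.
apply: (@leq_trans (#|dual_box (3 * d * s) y| ^ d * m ^ d)); first by rewrite leq_mul2r h orbT.
by rewrite -expnMn leq_exp2r//; apply: leq_trans hD _; rewrite leq_exp2r//; lia.
Qed.
End Family.

(* [E] makes the cut-off [theta] between small and large denominators an exact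
   quotient of [(E * k) ^ d]. *)
Lemma card_distinct_slopes (R : realType) (d k : nat) (V : eqType)
    (E := (2 * (3 * (6 * d) ^ d) ^ d)%N)
    (h : 'M['I_(E * k)]_d * 'cV['I_(E * k)]_d -> V) :
  (0 < d)%N -> (0 < k)%N ->
  (forall a b, h a = h b -> slope R d (E * k) a = slope R d (E * k) b) ->
  (((E * k) ^ d) ^ d.+1 <=
     size (undup (map h (enum xpredT))) * (2 * ((6 * d) ^ d) ^ d * E ^ d))%N.
Proof.
move=> d0 k0 hslope.
set C := ((6 * d) ^ d)%N; set s := (E * k)%N; set S := (s ^ d)%N.
have C0 : (0 < C)%N by rewrite expn_gt0 muln_gt0 d0.
have E0 : (0 < E)%N by rewrite muln_gt0/= expn_gt0 muln_gt0 C0.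
have s0 : (0 < s)%N by rewrite muln_gt0 E0.
pose theta := (E ^ d.-1 * k ^ d)%N.
have theta0 : (0 < theta)%N by rewrite muln_gt0 !expn_gt0 E0 k0.
have ST : S = (E * theta)%N by rewrite /theta mulnA -expnS prednK// -expnMn.
have EC : E = (2 * (3 * C) ^ d)%N by [].
clearbody theta.
have S0 : (0 < S)%N by rewrite expn_gt0 s0.
have CS : ((6 * d * s) ^ d)%N = (C * S)%N by rewrite expnMn.
have [m hm] := fin_all_exists (slope_denominator R d s d0 s0).
have m0 a : (0 < m a)%N by have [? []] := hm a.
have mint a : (m a)%:R *: slope R d s a \is a mxOver Num.int by have [? []] := hm a.
have fib a : (#|[set b | slope R d s b == slope R d s a]%SET| * m a ^ d
    <= (C * S) ^ d)%N.
  have [x [_ _ ix hx]] := hm a.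
  by have := card_slope_fiber R d s d0 s0 _ _ x (m0 a) ix hx; rewrite CS.
pose small := [set a | (m a <= theta)%N]%SET.
(* For each denominator j <= theta there are at most (2j + 1)^d slopes, each of multiplicity at most
   (C S)^d / j^d; since 2j + 1 <= 3j, the powers of [j] cancel. *)
have hsmall : (#|small| <= theta * (3 * C * S) ^ d)%N.
  rewrite -[X in (_ <= X * _)%N](size_iota 1 theta); apply: (@card_le_fibers _ _ _ m) => [a|j].
    by rewrite inE mem_iota m0 add1n ltnS.
  have [->|[a1]] := set_0Vmem [set a in small | m a == j]%SET.
    by rewrite cards0.
  rewrite !inE => /andP[_ /eqP ma1].
  have j0 : (0 < j)%N by rewrite -ma1.
  have jR : j%:R != 0 :> R by rewrite pnatr_eq0 -lt0n.
  apply: (@leq_trans ((2 * j).+1 ^ d * ((C * S) ^ d %/ j ^ d))).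
    (* The entries of a slope y lie in [-1, 1], so adding [j] to those of j y gives integers in
       [0, 2j]. *)
    pose Y : seq 'cV[R]_d := [seq j%:R^-1 *: (natmx v - const_mx j%:R) |
      v <- enum {: 'cV['I_(2 * j).+1]_d}].
    have -> : ((2 * j).+1 ^ d)%N = size Y.
      by rewrite size_map -cardE card_mx card_ord muln1.
    apply: (@card_le_fibers _ _ _ (slope R d s)) => [a|c].
      rewrite !inE => /andP[_ /eqP maj].
      have ent p q : (j%:R *: slope R d s a + const_mx j%:R) p q
          = j%:R * slope R d s a p q + j%:R by rewrite !mxE.
      have [||v hv] := @natmx_surj R d 1 (2 * j).+1 (j%:R *: slope R d s a + const_mx j%:R).
      - apply/mxOverP => p q; rewrite ent rpredD ?natr_int//.
        by have /mxOverP/(_ p q) := mint a; rewrite maj mxE.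
      - move=> p q; rewrite ent ord1.
        have := slope_le1 R d s d0 s0 a p; rewrite ler_norml => /andP[l1 l2].
        have jp : 0 < j%:R :> R by rewrite ltr0n.
        have e1 : j%:R * -1 <= j%:R * slope R d s a p 0 by rewrite ler_pM2l.
        have e2 : j%:R * slope R d s a p 0 <= j%:R * 1 by rewrite ler_pM2l.
        by rewrite -natr1 natrM; apply/andP; split; lra.
      apply/mapP; exists v; first by rewrite mem_enum.
      by rewrite hv addrK scalerA mulVf// scale1r.
    have [->|[a2]] := set_0Vmem [set a in [set a in small | m a == j] | slope R d s a == c]%SET.
      by rewrite cards0.
    rewrite !inE => /andP[/andP[_ /eqP ma2] /eqP ca2].
    rewrite leq_divRL ?expn_gt0 ?j0//.
    apply: leq_trans (fib a2); rewrite ma2 leq_mul2r; apply/orP; right.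
    by apply/subset_leq_card/fintype.subsetP => b; rewrite !inE ca2 => /andP[].
  apply: (@leq_trans (3 ^ d * (((C * S) ^ d %/ j ^ d) * j ^ d))).
    rewrite (mulnC (_ %/ _)%N) mulnA -expnMn leq_mul2r; apply/orP; right.
    by rewrite leq_exp2r//; lia.
  by rewrite -mulnA (expnMn 3) leq_mul2l leq_trunc_div orbT.
(* A fibre of [h] lies in a fibre of [slope], which for a denominator above [theta] has at most (C
   S)^d / theta^d members. *)
have hbig : (#|~: small| * theta ^ d
    <= size (undup (map h (enum xpredT))) * (C * S) ^ d)%N.
  apply: (@leq_trans (size (undup (map h (enum xpredT))) *
      ((C * S) ^ d %/ theta ^ d) * theta ^ d)); last first.
    by rewrite -mulnA leq_mul2l leq_trunc_div orbT.
  rewrite leq_mul2r; apply/orP; right.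
  apply: (@card_le_fibers _ _ _ h) => [a _|c].
    by rewrite mem_undup map_f// mem_enum.
  have [->|[a]] := set_0Vmem [set a in ~: small | h a == c]%SET.
    by rewrite cards0.
  rewrite !inE -ltnNge => /andP[ta /eqP ca].
  rewrite leq_divRL ?expn_gt0 ?theta0//.
  apply: leq_trans (fib a); apply: leq_mul; last by rewrite leq_exp2r// ltnW.
  apply/subset_leq_card/fintype.subsetP => b; rewrite !inE => /andP[_ /eqP cb].
  by apply/eqP/hslope; rewrite cb ca.
have tot : (#|small| + #|~: small| = S ^ d.+1)%N.
  by rewrite cardsC card_prod !card_mx card_ord muln1 expnM expnS mulnC.
(* Since E = 2 (3C)^d and S = E theta, twice the bound of [hsmall] is exactly S^(d+1). *)
have half : (S ^ d.+1 <= 2 * #|~: small|)%N.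
  have : (2 * #|small| <= S ^ d.+1)%N.
    apply: (leq_trans (leq_mul (leqnn 2) hsmall)).
    rewrite expnS [X in (_ <= X * _)%N]ST EC (expnMn (3 * C)).
    by rewrite [(2 * _ * theta)%N]mulnAC -!mulnA.
  by rewrite -tot; move: #|small| #|~: small| => u v; clear; lia.
(* As (C S)^d = C^d E^d theta^d, the factor theta^d cancels and the loss is independent of [k]. *)
rewrite -(leq_pmul2r (_ : 0 < theta ^ d)%N) ?expn_gt0 ?theta0//.
apply: (leq_trans (leq_mul half (leqnn _))); rewrite -mulnA.
apply: (leq_trans (leq_mul (leqnn 2) hbig)).
rewrite (expnMn C) ST (expnMn E).
by rewrite mulnCA !mulnA.
Qed.

(** * Cardinals of finite sets, the Euclidean norm, and spans of rows *)

Lemma card_fset_set_le (T : choiceType) (A : set T) (s : seq T) :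
  (forall x, A x -> x \in s) ->
  finite_set A /\ (#|` fset_set A| <= size s)%N.
Proof.
move=> As; have fA : finite_set A.
  by apply: (@sub_finite_set _ _ [set` s]%classic) => // x /As.
split=> //; apply: uniq_leq_size; first exact: fset_uniq.
by move=> x; rewrite in_fset_set// inE => /As.
Qed.

Lemma card_fset_set_ge (T : choiceType) (A : set T) (s : seq T) :
  finite_set A -> (forall x, x \in s -> A x) ->
  (size (undup s) <= #|` fset_set A|)%N.
Proof.
move=> fA sA; apply: uniq_leq_size; first exact: undup_uniq.
by move=> x; rewrite mem_undup in_fset_set// inE => /sA.
Qed.

Section EuclNorm.
Variables (R : realType) (n : nat).
Implicit Type v : 'rV[R]_n.

Lemma normr_le_eucl_norm v i : `|v 0 i| <= eucl_norm v.
Proof.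
rewrite /eucl_norm -sqrtr_sqr ler_wsqrtr// (bigD1 i)//= lerDl sumr_ge0// => j _.
exact: sqr_ge0.
Qed.

Lemma eucl_norm_le v (b : R) : (forall i, `|v 0 i| <= b) ->
  eucl_norm v <= n%:R * b.
Proof.
move=> hb.
have b0 : 0 <= n%:R * b.
  case: n v hb => [|m] v hb; first by rewrite mul0r.
  by rewrite mulr_ge0// (le_trans _ (hb ord0)).
rewrite /eucl_norm -[leRHS]ger0_norm// -sqrtr_sqr ler_wsqrtr//.
apply: (@le_trans _ _ (\sum_(i < n) b ^+ 2)).
  by apply: ler_sum => i _; rewrite -real_normK ?num_real// ler_sqr ?nnegrE// (le_trans _ (hb i)).
rewrite sumr_const card_ord -[leLHS]mulr_natl exprMn ler_wpM2r ?sqr_ge0//.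
by rewrite -natrX ler_nat; nia.
Qed.
End EuclNorm.

Definition row_span (R : realType) (p n : nat) (M : 'M[R]_(p, n)) :
    {vspace 'rV[R]_n} :=
  <<[tuple row i M | i < p]>>%VS.

Section RowSpan.
Variables (R : realType) (p n : nat) (M : 'M[R]_(p, n)).

Lemma sum_rows (c : 'I_p -> R) :
  \sum_i c i *: [tuple row i M | i < p]`_i = (\row_i c i) *m M.
Proof.
rewrite mulmx_sum_row; apply: eq_bigr => i _.
by rewrite -tnth_nth tnth_mktuple mxE.
Qed.

Lemma mem_row_span v : v \in row_span R p n M -> exists c : 'rV[R]_p, v = c *m M.
Proof. by move=> /coord_span ->; rewrite sum_rows; eexists. Qed.

Lemma row_mem_span i : row i M \in row_span R p n M.
Proof. by apply/memv_span/mapP; exists i; rewrite ?mem_enum. Qed.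

Lemma rows_free : (forall c : 'rV[R]_p, c *m M = 0 -> c = 0) ->
  free [tuple row i M | i < p].
Proof.
move=> h; apply/freeP => c; rewrite sum_rows => /h/rowP e i.
by have := e i; rewrite !mxE.
Qed.
End RowSpan.

(** * The upper bound *)

Lemma lattice_hyperplanes_upper (R : realType) (n : nat) (r : R) : 1 <= r ->
  finite_set (lattice_hyperplanes n r) /\
  (#|` fset_set (lattice_hyperplanes n r)|)%:R <= (3 * r) ^+ (n * (n - 1)).
Proof.
move=> r1; have r0 : 0 <= r by lra.
(* Integer coordinates bounded by [r] are bounded by its integer part [N]; adding [N] moves them
   into [0, 2N]. *)
pose N := Num.truncn r; pose L := (2 * N).+1.
have [Nr _] := andP (truncn_itv r0).
pose s : seq {vspace 'rV[R]_n} :=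
  [seq row_span R n.-1 n (natmx A - const_mx N%:R) | A <- enum {: 'M['I_L]_(n.-1, n)}].
have [|fH cH] := card_fset_set_le _ (lattice_hyperplanes n r) s.
  move=> U [dU [X [fX hX]]].
  have hXi i j : (tnth X i 0 j \is a Num.int) && (`|tnth X i 0 j| <= N%:R).
    have [_ /mxOverP iX nX] := hX _ (mem_tnth i X).
    rewrite iX/=; have /natrP[k hk] := natr_norm_int (iX 0 j).
    rewrite hk ler_nat truncn_ge_nat// -hk.
    exact: le_trans (normr_le_eucl_norm _ _ _ _) nX.
  have [||A hA] := @natmx_surj R n.-1 n L (\matrix_(i, j) (tnth X i 0 j) + const_mx N%:R).
  - apply/mxOverP => i j; rewrite !mxE rpredD ?natr_int//.
    by have /andP[] := hXi i j.
  - move=> i j; rewrite !mxE; have /andP[_] := hXi i j.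
    rewrite ler_norml -natr1 natrM => /andP[h1 h2]; apply/andP; split; lra.
  apply/mapP; exists A; rewrite ?mem_enum// hA addrK.
  have eX : X = [tuple row i (\matrix_(i, j) (tnth X i 0 j)) | i < n.-1].
    apply: eq_from_tnth => i; rewrite tnth_mktuple; apply/rowP => j.
    by rewrite !mxE.
  (* The tuple [X] spans a subspace of [U] of the same dimension, hence [U] itself. *)
  rewrite /row_span -eX; apply/esym/eqP; rewrite eqEdim; apply/andP; split.
    by apply/span_subvP => v /hX[].
  by rewrite dU (eqP (fX : \dim <<X>> == size X)) size_tuple.
split=> //; apply: (@le_trans _ _ (size s)%:R); first by rewrite ler_nat.
rewrite size_map -cardE card_mx card_ord subn1 mulnC natrX.
have LR : L%:R <= 3 * r.
  have -> : L%:R = 2 * N%:R + 1 :> R by rewrite /L -addn1 natrD natrM.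
  by lra.
by apply: lerXn2r => //; rewrite nnegrE ?ler0n//; lra.
Qed.

(** * The lower bound *)

Definition lattice_span (R : realType) (d s : nat) (a : 'M['I_s]_d * 'cV['I_s]_d) :
    {vspace 'rV[R]_(1 + d)} :=
  row_span R d (1 + d) (row_mx (natmx a.2) (perturbed_scalar R d s a)).

Section LatticeSpan.
Variables (R : realType) (d s : nat).
Hypotheses (d_gt0 : (0 < d)%N) (s_gt0 : (0 < s)%N).
Implicit Type a : 'M['I_s]_d * 'cV['I_s]_d.

(** The span of the rows of [w | B] is the graph of the functional u -> u.y, consisting of the
    vectors (u.y, u), so it determines y. The pair itself need not be recovered. *)
Lemma lattice_span_inj a b : lattice_span R d s a = lattice_span R d s b ->
  slope R d s a = slope R d s b.
Proof.
move=> e.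
suff h : perturbed_scalar R d s a *m slope R d s b = natmx a.2.
  by rewrite /slope -h mulKmx// perturbed_scalar_unit.
apply/row_matrixP => i.
have := row_mem_span _ _ _ (row_mx (natmx a.2) (perturbed_scalar R d s a)) i.
rewrite -/(lattice_span R d s a) e => /mem_row_span[c].
rewrite row_row_mx mul_mx_row => /eq_row_mx[-> eB].
by rewrite row_mul eB -mulmxA perturbed_scalarM_slope.
Qed.

Lemma lattice_span_hyperplane a (r : R) : ((1 + d) * (3 * d * s))%:R <= r ->
  lattice_hyperplanes (1 + d) r (lattice_span R d s a).
Proof.
move=> hr; set M := row_mx (natmx a.2) (perturbed_scalar R d s a).
have fM : free [tuple row i M | i < d].
  apply: rows_free => c; rewrite /M mul_mx_row -row_mx0 => /eq_row_mx[_ cB].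
  by rewrite -[c](mulmxK (perturbed_scalar_unit R d s d_gt0 s_gt0 a)) cB mul0mx.
split; first by rewrite /lattice_span /row_span (eqP (fM : \dim _ == _)) size_tuple.
exists [tuple row i M | i < d]; split=> // v /mapP[i _ ->].
have hM j : exists2 k : nat, M i j = k%:R & (k <= 3 * d * s)%N.
  case: (split_ordP j) => k ->.
    by rewrite row_mxEl; exists (a.2 i k); rewrite ?mxE//; have := ltn_ord (a.2 i k); nia.
  rewrite row_mxEr; exists (2 * d * s * (i == k) + a.1 i k)%N.
    by rewrite !mxE natrD [in RHS]natrM mulr_natr.
  by have := ltn_ord (a.1 i k); case: (i == k); nia.
split; first exact: row_mem_span.
  by apply/mxOverP => o j; rewrite mxE; have [k -> _] := hM j; rewrite natr_int.
apply: le_trans hr; rewrite natrM; apply: eucl_norm_le => j.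
by rewrite mxE; have [k -> hk] := hM j; rewrite ger0_norm// ler_nat.
Qed.
End LatticeSpan.

Lemma lattice_hyperplanes_lower (R : realType) (d : nat) : (0 < d)%N ->
  exists2 c : R, 0 < c & exists r0 : R, forall r : R, r0 <= r ->
    finite_set (lattice_hyperplanes d.+1 r) ->
    c * r ^+ (d * d.+1) <= (#|` fset_set (lattice_hyperplanes d.+1 r)|)%:R.
Proof.
move=> d0; pose E := (2 * (3 * (6 * d) ^ d) ^ d)%N.
pose F := (2 * ((6 * d) ^ d) ^ d * E ^ d)%N.
pose K := ((1 + d) * (3 * d * E))%N.
have E0 : (0 < E)%N by rewrite muln_gt0/= !(expn_gt0, muln_gt0) d0.
have F0 : (0 < F)%N by rewrite muln_gt0 (expn_gt0 E) E0 !(expn_gt0, muln_gt0) d0.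
have K0 : (0 < K)%N by rewrite muln_gt0 (muln_gt0 _ E) muln_gt0 d0 E0.
have KR : 0 < K%:R :> R by rewrite ltr0n.
have FR : 0 < F%:R :> R by rewrite ltr0n.
(* [F] is the loss in [card_distinct_slopes], and the power of 2K is the cost of replacing [r] by
   [k]. *)
exists (((2 * K%:R) ^+ (d * d.+1) * F%:R)^-1).
  by rewrite invr_gt0 mulr_gt0// exprn_gt0// mulr_gt0.
exists K%:R => r rK fH.
have r0 : 0 <= r by apply: le_trans rK.
(* With s = E k, the norm condition of [lattice_span_hyperplane] reads K k <= r. Conversely r < K (k
   + 1) <= 2 K k, because k >= 1. *)
pose k := Num.truncn (r / K%:R).
have rK0 : 0 <= r / K%:R by rewrite divr_ge0.
have k0 : (0 < k)%N by rewrite truncn_gt0 ler_pdivlMr ?mul1r.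
have /andP[kr rk] := truncn_itv rK0.
have := card_distinct_slopes R d k _ (lattice_span R d (E * k)) d0 k0.
move=> /(_ (lattice_span_inj R d (E * k) d0 _)).
rewrite muln_gt0 E0 k0 => /(_ isT).
rewrite -/E -/F; set Y := size _ => hY.
have YH : (Y <= #|` fset_set (lattice_hyperplanes d.+1 r)|)%N.
  apply: card_fset_set_ge => // x /mapP[a _ ->].
  apply: (lattice_span_hyperplane R d (E * k)) => //; first by rewrite muln_gt0 E0.
  rewrite (_ : (_ * _)%N = (k * K)%N); last by rewrite /K; lia.
  by rewrite natrM -ler_pdivlMr.
rewrite mulrC ler_pdivrMr ?mulr_gt0 ?exprn_gt0 ?mulr_gt0//.
apply: (@le_trans _ _ ((2 * K%:R) ^+ (d * d.+1) * (Y * F)%:R)); last first.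
  rewrite natrM mulrCA ler_wpM2r ?mulr_ge0 ?exprn_ge0 ?mulr_ge0 ?ler_nat//.
apply: (@le_trans _ _ ((2 * K%:R) ^+ (d * d.+1) * (k ^ (d * d.+1))%:R)).
  rewrite natrX -exprMn lerXn2r// ?nnegrE// ?mulr_ge0 ?mulr_ge0//.
  have : 1 <= k%:R :> R by rewrite ler1n.
  move: rk; rewrite -/k ltr_pdivrMr// -natr1 => rk k1.
  have : K%:R * 1 <= K%:R * k%:R :> R by rewrite ler_pM2l.
  lra.
rewrite ler_wpM2l ?exprn_ge0 ?mulr_ge0// ler_nat; apply: leq_trans hY.
by rewrite -expnM leq_exp2r ?muln_gt0 ?d0// leq_pmull.
Qed.

Local Open Scope classical_set_scope.

Theorem theorem3 (R : realType) (n : nat) (hn : (2 <= n)%N) :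
  exists c1 c2 : R, 0 < c1 /\ 0 < c2 /\
    \forall r \near +oo,
      finite_set (lattice_hyperplanes n r) /\
      c1 * r ^+ (n * (n - 1))
        <= (#|` fset_set (lattice_hyperplanes n r)|)%:R
        <= c2 * r ^+ (n * (n - 1)).
Proof.
case: n hn => [|d] // hd; have d0 : (0 < d)%N by [].
have [c c0 [r0 hr]] := lattice_hyperplanes_lower R d d0.
exists c, (3 ^+ (d.+1 * (d.+1 - 1))); split=> //; split; first by rewrite exprn_gt0.
near=> r.
have r1 : 1 <= r by near: r; exact: nbhs_pinfty_ge.
have [fH uH] := lattice_hyperplanes_upper R d.+1 r r1.
have rr : r0 <= r by near: r; apply: nbhs_pinfty_ge; rewrite num_real.
split=> //; rewrite -exprMn uH andbT subn1 mulnC; exact: hr.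
Unshelve. all: by end_near.
Qed.
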